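(* Let $f$ be a probability density on $\mathbb{R}$ with $f\in L^2(\mathbb{R})$ and with weak second derivative $f''\in L^2(\mathbb{R})$. Let $K:\mathbb{R}\to\mathbb{R}$ satisfy $K\in L^1(\mathbb{R})\cap L^2(\mathbb{R})$, $\int K(u)\,du=1$, $\int uK(u)\,du=0$ and $\int u^2|K(u)|\,du<\infty$. Assume that $\mu_2(K)^2R(f'')>0$. Then, for each $n\geq 1$, the bandwidth $h>0$ that minimizes $$\operatorname{AMISE}(\widehat f_h)=\frac{h^4}{4}\mu_2(K)^2R(f'')+\frac{R(K)}{nh}$$ is given by $$h_{\operatorname{AMISE}}=\left(\frac{R(K)}{\mu_2(K)^2R(f'')\,n}\right)^{1/5}.$$ In particular, $h_{\operatorname{AMISE}}\asymp n^{-1/5}$ (as $n\to\infty$) whenever $R(K)$ and $R(f'')$ are fixed positive constants.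
   Context: Notation: $\mu_2(K)=\int_{\mathbb{R}}u^2K(u)\,du$ and $R(g)=\int_{\mathbb{R}}g(x)^2\,dx$. A function $g\in L^1_{\mathrm{loc}}(\mathbb{R})$ is the weak second derivative of $f$, written $g=f''$, if $\int g\varphi\,dx=\int f\varphi''\,dx$ for every smooth compactly supported $\varphi$. The notation $\operatorname{AMISE}(\widehat f_h)$ denotes the displayed function of $h$ (for given $n$). $a_n\asymp b_n$ means that $a_n/b_n$ is bounded above and bounded away from zero for all large $n$. *)

(* Defs.v *)
From HB Require Import structures.
From mathcomp Require Import all_boot all_order all_algebra.
From mathcomp Require Import all_classical all_reals all_analysis.
Set Implicit Arguments.
Unset Strict Implicit.
Unset Printing Implicit Defensive.
Import Order.TTheory GRing.Theory Num.Theory.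
Import numFieldNormedType.Exports.
Local Open Scope classical_set_scope.
Local Open Scope ring_scope.

(* [lebesgue_measure] lives on the Borel sigma-algebra, so "measurable" means
   Borel measurable throughout; every Lebesgue class has a Borel representative,
   and all the quantities below depend only on the class. *)

Definition prob_density (R : realType) (f : R -> R) : Prop :=
  [/\ measurable_fun [set: R] f,
      forall x, 0 <= f x
    & (\int[lebesgue_measure]_x (f x)%:E = 1)%E].

Definition test_function (R : realType) (phi : R -> R) : Prop :=
  (forall (k : nat) (x : R), derivable (derive1n k phi) x 1) /\
  compact (closure [set x | phi x != 0]).

Definition weak_second_derivative (R : realType) (f g : R -> R) : Prop :=
  locally_integrable [set: R] g /\
  forall phi : R -> R, test_function phi ->
    \int[lebesgue_measure]_x (g x * phi x) =
    \int[lebesgue_measure]_x (f x * derive1n 2 phi x).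

Definition mu2 (R : realType) (K : R -> R) : R :=
  \int[lebesgue_measure]_x (x ^+ 2 * K x).

Definition roughness (R : realType) (g : R -> R) : R :=
  \int[lebesgue_measure]_x (g x ^+ 2).

(* [f2] stands for the (weak) second derivative of the density. *)
Definition AMISE (R : realType) (K f2 : R -> R) (n : nat) (h : R) : R :=
  h ^+ 4 / 4 * mu2 K ^+ 2 * roughness f2 + roughness K / (n%:R * h).

Definition h_AMISE (R : realType) (K f2 : R -> R) (n : nat) : R :=
  (roughness K / (mu2 K ^+ 2 * roughness f2 * n%:R)) `^ (1 / 5).

Definition asymp (R : realType) (a b : nat -> R) : Prop :=
  exists c C : R, 0 < c /\ \forall n \near \oo, c <= a n / b n <= C.

(* Main.v *)
Require Import Defs.
From HB Require Import structures.
From mathcomp Require Import all_boot all_order all_algebra.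
From mathcomp Require Import all_classical all_reals all_analysis.
From mathcomp Require Import ring.
Import Order.TTheory GRing.Theory Num.Theory.
Import numFieldNormedType.Exports.
Local Open Scope classical_set_scope.
Local Open Scope ring_scope.

(** As a function of the bandwidth, the criterion has the shape [A h^4/4 + b/h] with
    [A > 0] and [b = R(K)/n].  Writing [b = A h0^5], its excess over its value at [h0]
    factors as [A (h - h0)^2 Q(h) / (4h)], where [Q] is a cubic with positive
    coefficients: so [h0 = (b/A)^(1/5)] is the strict global minimizer on the half-line
    ([bandwidth_excess], [bandwidth_argmin]).

    This presupposes [b > 0], that is [R(K) > 0].  A square-integrable function whose
    square has integral zero vanishes almost everywhere, which [\int K = 1] forbids
    ([Lfun2_Rintegral_sqr_gt0]).

    For the rate, when [n >= 1] the ratio of the minimizer to [n^(-1/5)] is the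
    constant [(R(K)/A)^(1/5)] ([h_AMISE_factor]), which serves as both bounds. *)

(** If the integral of [g^2] were [0], then [g = 0] almost everywhere, hence
    [\int g = 0].  Membership in L^2 also excludes that the real-valued integral of
    [g^2] is [0] only because it sends an infinite value to [0]. *)
Lemma Lfun2_Rintegral_sqr_gt0 (d : measure_display) (T : measurableType d)
    (R : realType) (mu : {measure set T -> \bar R}) (g : T -> R) :
  g \in Lfun mu 2%:E -> \int[mu]_x g x != 0 -> 0 < \int[mu]_x (g x ^+ 2).
Proof.
move=> gL2 int_g_neq0.
have mg : measurable_fun setT g by have := sub_Lfun_mfun gL2; rewrite inE.
have sqr_integrable := Lfun2_integrable_sqr gL2.
have int_ge0 : 0 <= \int[mu]_x (g x ^+ 2).
  by apply: Rintegral_ge0 => x _; exact: sqr_ge0.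
rewrite lt_neqAle int_ge0 andbT; apply: contra int_g_neq0 => /eqP/esym int0.
have int_sqr0 : (\int[mu]_x `|(EFin \o (fun x => g x ^+ 2)%R) x| = 0)%E.
  rewrite (eq_integral (EFin \o (fun x => g x ^+ 2)%R)) => [|x _]; last first.
    by rewrite gee0_abs// lee_fin sqr_ge0.
  rewrite -(fineK (integrable_fin_num measurableT sqr_integrable)).
  by congr (_%:E); rewrite -[RHS]int0.
have g_ae0 : ae_eq mu setT (EFin \o g) (cst 0%E).
  move/ae_eq_integral_abs: int_sqr0.
  move=> /(_ measurableT (measurable_int _ sqr_integrable)).
  apply: filterS => x /= /(_ I) [/eqP].
  by rewrite sqrf_eq0 => /eqP ->.
rewrite /Rintegral (ae_eq_integral (cst 0%E))// ?integral0//.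
exact/measurable_realfun.measurable_EFinP.
Qed.

(** After multiplication by [4h/A], the left-hand side is
    [h^5 - 5 h0^4 h + 4 h0^5].  The critical point [h0] is a double root of it, and
    dividing by [(h - h0)^2] leaves the cubic. *)
Lemma bandwidth_excess (F : realFieldType) (A h0 h : F) : h0 != 0 -> h != 0 ->
  (h ^+ 4 / 4 * A + A * h0 ^+ 5 / h) - (h0 ^+ 4 / 4 * A + A * h0 ^+ 5 / h0) =
  A / (4 * h) * (h - h0) ^+ 2 *
    (h ^+ 3 + 2 * h ^+ 2 * h0 + 3 * h * h0 ^+ 2 + 4 * h0 ^+ 3).
Proof. by move=> h0_neq0 h_neq0; field; rewrite h0_neq0 h_neq0. Qed.

(** The excess is a square times a positive weight: it is never negative, and it
    vanishes at [h0] alone, which gives existence and uniqueness together. *)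
Lemma bandwidth_argmin (F : realFieldType) (A h0 h : F) (Phi : F -> F) :
  0 < A -> 0 < h0 ->
  (forall x, 0 < x -> Phi x = x ^+ 4 / 4 * A + A * h0 ^+ 5 / x) ->
  (0 < h /\ forall h', 0 < h' -> Phi h <= Phi h') <-> h = h0.
Proof.
move=> A_gt0 h0_gt0 PhiE.
have weight_gt0 x : 0 < x ->
    0 < A / (4 * x) * (x ^+ 3 + 2 * x ^+ 2 * h0 + 3 * x * h0 ^+ 2 + 4 * h0 ^+ 3).
  by move=> x_gt0; rewrite !(mulr_gt0, addr_gt0, invr_gt0, exprn_gt0).
have excess x : 0 < x -> Phi x - Phi h0 = A / (4 * x) *
    (x ^+ 3 + 2 * x ^+ 2 * h0 + 3 * x * h0 ^+ 2 + 4 * h0 ^+ 3) * (x - h0) ^+ 2.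
  move=> x_gt0; rewrite !PhiE// bandwidth_excess ?gt_eqF//.
  by rewrite mulrAC.
split=> [[h_gt0 /(_ h0 h0_gt0)]|->].
  rewrite -subr_le0 excess// pmulr_rle0 ?weight_gt0// => sqr_le0.
  by apply/eqP; rewrite -subr_eq0 -sqrf_eq0 eq_le sqr_le0 sqr_ge0.
split=> // x x_gt0; rewrite -subr_ge0 excess//.
by rewrite mulr_ge0 ?sqr_ge0// ltW// weight_gt0.
Qed.

Lemma powR_inv5K (R : realType) (x : R) : 0 <= x -> (x `^ (1 / 5)) ^+ 5 = x.
Proof.
move=> x_ge0; rewrite -powR_mulrn ?powR_ge0// -powRrM.
by rewrite div1r mulVf ?pnatr_eq0// powRr1.
Qed.

Lemma h_AMISE_factor (R : realType) (K f2 : R -> R) (n : nat) :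
  0 <= roughness K -> 0 <= mu2 K ^+ 2 * roughness f2 ->
  h_AMISE K f2 n =
  (roughness K / (mu2 K ^+ 2 * roughness f2)) `^ (1 / 5) * n%:R `^ (- (1 / 5)).
Proof.
move=> RK_ge0 A_ge0; rewrite /h_AMISE invfM mulrA powRM ?invr_ge0//.
  by rewrite -(powR_inv1 (ler0n _ n)) -powRrM mulN1r.
by rewrite divr_ge0.
Qed.

Theorem corollary4p4 (R : realType) (f f2 K : R -> R)
  (f_density : prob_density f)
  (f_L2 : f \in Lfun (@lebesgue_measure R) 2%:E)
  (f2_weak : weak_second_derivative f f2)
  (f2_L2 : f2 \in Lfun (@lebesgue_measure R) 2%:E)
  (K_L1 : K \in Lfun (@lebesgue_measure R) 1%:E)
  (K_L2 : K \in Lfun (@lebesgue_measure R) 2%:E)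
  (K_int1 : \int[lebesgue_measure]_u (K u) = 1)
  (K_mean0 : \int[lebesgue_measure]_u (u * K u) = 0)
  (K_moment2 : (\int[lebesgue_measure]_u (u ^+ 2 * `|K u|)%:E < +oo)%E)
  (pos : 0 < mu2 K ^+ 2 * roughness f2) :
  (forall n : nat, (1 <= n)%N -> forall h : R,
     (0 < h /\ forall h' : R, 0 < h' -> AMISE K f2 n h <= AMISE K f2 n h')
     <-> h = h_AMISE K f2 n) /\
  (0 < roughness K -> 0 < roughness f2 ->
     asymp (fun n : nat => h_AMISE K f2 n) (fun n : nat => n%:R `^ (- (1 / 5)))).
Proof.
have RK_gt0 : 0 < roughness K.
  by apply: Lfun2_Rintegral_sqr_gt0; rewrite // K_int1 oner_neq0.
split=> [n n_gt0 h|_ _].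
  have n_gt0R : 0 < n%:R :> R by rewrite ltr0n.
  have ratio_gt0 : 0 < roughness K / (mu2 K ^+ 2 * roughness f2 * n%:R).
    by rewrite divr_gt0// mulr_gt0.
  apply: (@bandwidth_argmin _ (mu2 K ^+ 2 * roughness f2)) => //.
    exact: powR_gt0.
  move=> x x_gt0; rewrite powR_inv5K ?ltW// /AMISE -mulrA; congr (_ + _).
  have [A_neq0 x_neq0] := (lt0r_neq0 pos, lt0r_neq0 x_gt0).
  have n_neq0 := lt0r_neq0 n_gt0R.
  move: (mu2 K ^+ 2 * _) A_neq0 => A A_neq0.
  by field; rewrite A_neq0 n_neq0 x_neq0.
pose c := (roughness K / (mu2 K ^+ 2 * roughness f2)) `^ (1 / 5).
exists c, c; split; first by rewrite powR_gt0// divr_gt0.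
near=> n.
have n_gt0 : 0 < n%:R :> R by rewrite ltr0n; near: n; exists 1%N.
have rate_neq0 : n%:R `^ (- (1 / 5)) != 0 :> R by rewrite gt_eqF// powR_gt0.
rewrite (h_AMISE_factor _ _ _ _ (ltW RK_gt0) (ltW pos)).
by rewrite mulfK// lexx.
Unshelve. all: by end_near.
Qed.
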